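(* For $n\geq 0$, $$F_{n+1}^I(x,y,q)F_n^I(x,y,q)=\sum_{j=0}^{n}x\,y^{n-j}q^{(n-j)(n+j-1)+j}\left(F_j^I(x,y,q)\right)^2.$$
   Context: $S_n(123,132,213)$ is the set of permutations of $[n]$ with no subsequence order isomorphic to $123$, $132$ or $213$; each such $\pi$ is a concatenation of increasing blocks of size $1$ or $2$, each block larger than all later blocks. $s(\pi)$, $d(\pi)$ are the numbers of maximal increasing runs of $\pi$ of length $1$ and $2$, and $inv(\pi)$ is the number of inversions. $F_n^I(x,y,q)=\sum_{\pi\in S_n(123,132,213)}x^{s(\pi)}y^{d(\pi)}q^{inv(\pi)}$ (so $F_0^I=1$). *)

(* Defs.v *)
From mathcomp Require Import all_boot all_order all_algebra all_fingroup.

Set Implicit Arguments.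
Unset Strict Implicit.
Unset Printing Implicit Defensive.

Import GRing.Theory.

Local Open Scope nat_scope.

(* One-line notation of [p]; positions and values are 0-based, i.e. [n] is
   {0, ..., n - 1}, which affects none of the notions below. *)
Definition word n (p : 'S_n) : seq nat := [seq val (p i) | i <- enum 'I_n].

Definition order_iso (s t : seq nat) : bool :=
  (size s == size t) &&
  [forall i : 'I_(size s), forall j : 'I_(size s),
     (nth 0 s i < nth 0 s j) == (nth 0 t i < nth 0 t j)].

(* [mask m w], for [m] of the same size as [w], ranges over the subsequences
   of [w]; see [containsP]. *)
Definition contains n (t : seq nat) (p : 'S_n) : bool :=
  [exists m : n.-tuple bool, order_iso (mask m (word p)) t].

Definition avoiders n : {set 'S_n} :=
  [set p : 'S_n | [&& ~~ contains [:: 1; 2; 3] p,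
                      ~~ contains [:: 1; 3; 2] p
                    & ~~ contains [:: 2; 1; 3] p]].

(* Decomposition of a sequence into its maximal increasing runs; [runs] is
   characterized by [flatten_runs], [runs_increasing] and [runs_maximal]. *)
Fixpoint runs (w : seq nat) : seq (seq nat) :=
  if w is a :: w' then
    match runs w' with
    | (b :: r) :: rs => if a < b then (a :: b :: r) :: rs
                        else [:: a] :: (b :: r) :: rs
    | _ => [:: [:: a]]
    end
  else [::].

Definition num_runs n (k : nat) (p : 'S_n) : nat :=
  count (fun r => size r == k) (runs (word p)).

Definition inv n (p : 'S_n) : nat :=
  #|[set ij : 'I_n * 'I_n | (ij.1 < ij.2) && (p ij.2 < p ij.1)]|.

(* Taking [R] to be a polynomial ring and [x], [y], [q] its variables gives the
   generating function with formal indeterminates. *)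
Definition FI (R : comNzRingType) (n : nat) (x y q : R) : R :=
  (\sum_(p in avoiders n)
     x ^+ num_runs 1 p * y ^+ num_runs 2 p * q ^+ inv p)%R.

Lemma size_word n (p : 'S_n) : size (word p) = n.
Proof. by rewrite size_map size_enum_ord. Qed.

Lemma containsP n (t : seq nat) (p : 'S_n) :
  reflect (exists2 s, subseq s (word p) & order_iso s t) (contains t p).
Proof.
apply: (iffP existsP) => [[m st]|[s /subseqP[m sz ->] st]].
  by exists (mask m (word p)) => //; apply: mask_subseq.
have sz' : size m == n by rewrite sz size_word.
by exists (Tuple sz').
Qed.

Lemma runs_nonempty (w : seq nat) : all (fun r => 0 < size r) (runs w).
Proof.
by elim: w => //= a w; case: (runs w) => [|[|b r] rs] //=; case: ifP.
Qed.

Lemma flatten_runs (w : seq nat) : flatten (runs w) = w.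
Proof.
elim: w => //= a w; have := runs_nonempty w.
case: (runs w) => [|[|b r] rs] //= _ <- //.
by case: ifP.
Qed.

Lemma runs_increasing (w : seq nat) : all (sorted ltn) (runs w).
Proof.
elim: w => //= a w; case: (runs w) => [|[|b r] rs] //= /andP[br rsP].
by case: ifP => /= [->|_]; rewrite br.
Qed.

Lemma runs_maximal (w : seq nat) :
  sorted (fun r1 r2 => head 0 r2 <= last 0 r1) (runs w).
Proof.
elim: w => //= a w; case: (runs w) => [|[|b r] rs] //=.
case: ltnP => [_|ba] /= rsP; last by rewrite ba.
by case: rs rsP.
Qed.

Lemma FI0 (R : comNzRingType) (x y q : R) : FI 0 x y q = 1%R.
Proof.
have E (p : 'S_0) : word p = [::] by apply: size0nil; rewrite size_word.
rewrite /FI (eq_bigl predT) => [|p]; last first.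
  rewrite inE /=; apply/and3P; split; apply/negP => /containsP[s];
  by rewrite E subseq0 => /eqP-> /andP[].
rewrite (eq_bigr (fun=> 1%R)) => [|p _]; last first.
  rewrite /num_runs E /inv.
  have -> : [set ij : 'I_0 * 'I_0 | (ij.1 < ij.2) && (p ij.2 < p ij.1)] = set0.
    by apply/setP => -[[]].
  by rewrite cards0 !expr0 !mulr1.
by rewrite sumr_const card_Sn.
Qed.

(* Main.v *)
(* Every triple of entries of an avoider is ordered as 231, 312 or 321, so
   avoidance means that any two nonadjacent entries form an inversion.  Hence
   an avoider of size n+2 starts either with its maximum n+1 or with n, n+1,
   which gives F_{n+2} = x q^{n+1} F_{n+1} + y q^{2n} F_n.  Multiplying by
   F_{n+1} and inducting on n yields the identity. *)
Require Import Defs.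
From mathcomp Require Import all_boot all_order all_algebra all_fingroup.
From mathcomp Require Import zify ring.

Set Implicit Arguments.
Unset Strict Implicit.
Unset Printing Implicit Defensive.

Import GRing.Theory.

Local Open Scope nat_scope.

(** * Avoidance as a condition on triples of entries *)

(** The middle entry [b] only witnesses that [a] and [c] are not adjacent. *)
Definition gap_decreasing (w : seq nat) : Prop :=
  forall a b c, subseq [:: a; b; c] w -> c < a.

Lemma gap_decreasing_subseq (v w : seq nat) :
  subseq v w -> gap_decreasing w -> gap_decreasing v.
Proof. by move=> vw gw a b c sv; apply: (gw a b c); apply: subseq_trans vw. Qed.

(** Each of 123, 132 and 213 has its first entry below its third, so any occurrence of one of them
    violates [gap_decreasing]. *)
Lemma order_iso3_ltn (s t : seq nat) :
  size t = 3 -> nth 0 t 0 < nth 0 t 2 -> order_iso s t ->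
  exists a b c, s = [:: a; b; c] /\ a < c.
Proof.
move=> st lt_t /andP[/eqP]; rewrite st.
case: s => [|a [|b [|c [|d s]]]] //= _ /forallP/(_ (@Ordinal 3 0 isT)).
move=> /forallP/(_ (@Ordinal 3 2 isT)) /=; rewrite lt_t => /eqP ac.
by exists a, b, c.
Qed.

(** With [a < c] fixed, the three patterns correspond to [b] lying between [a] and [c], above both,
    or below both. *)
Lemma order_iso3 (a b c : nat) : a != b -> b != c -> a < c ->
  [|| order_iso [:: a; b; c] [:: 1; 2; 3],
      order_iso [:: a; b; c] [:: 1; 3; 2]
    | order_iso [:: a; b; c] [:: 2; 1; 3]].
Proof.
move=> ab bc ac.
have [ba|ba] := ltnP b a; [apply/or3P/Or33|have [cb|cb] := ltnP c b;
  [apply/or3P/Or32|apply/or3P/Or31]];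
  rewrite /order_iso eqxx; apply/forallP => -[[|[|[|i]]] Hi] //;
  apply/forallP => -[[|[|[|j]]] Hj] //=; apply/eqP; lia.
Qed.

Lemma uniq_word n (p : 'S_n) : uniq (word p).
Proof.
rewrite map_inj_uniq ?enum_uniq // => i j /val_inj; exact: perm_inj.
Qed.

Lemma avoidersP n (p : 'S_n) :
  reflect (gap_decreasing (word p)) (p \in avoiders n).
Proof.
rewrite inE -!negb_or; apply: (iffP idP) => [av a b c sw|gw].
  rewrite ltnNge leq_eqVlt; apply/negP => ac; case/negP: av.
  have := subseq_uniq sw (uniq_word p).
  rewrite /= !inE negb_or => /and3P[/andP[ab nac] bc _].
  move: ac; rewrite (negbTE nac) /= => ac.
  have [E|E|E] := or3P (order_iso3 ab bc ac); apply/or3P;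
    [apply: Or31|apply: Or32|apply: Or33];
    by apply/containsP; exists [:: a; b; c].
apply/negP => /or3P H.
have [s sw [a [b [c [es ac]]]]] : exists2 s, subseq s (word p) &
    exists a b c, s = [:: a; b; c] /\ a < c.
  by case: H => /containsP[s sw /order_iso3_ltn Hs]; exists s => //; apply: Hs.
by move: sw; rewrite es => /gw; rewrite ltnNge (ltnW ac).
Qed.

(** * Permutations versus words *)

Lemma word_inj n : injective (@word n).
Proof.
move=> p1 p2 /eq_in_map E; apply/permP => i; apply: val_inj.
by apply: E; rewrite mem_enum.
Qed.

Lemma nth_word n (p : 'S_n) (i : 'I_n) : nth 0 (word p) i = p i.
Proof. by rewrite (nth_map i) ?size_enum_ord // nth_ord_enum. Qed.

Lemma perm_eq_word n (p : 'S_n) : perm_eq (word p) (iota 0 n).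
Proof.
rewrite -val_enum_ord /word (map_comp val p); apply: perm_map.
apply: uniq_perm => [||i].
- by rewrite (map_inj_uniq (@perm_inj _ p)) enum_uniq.
- exact: enum_uniq.
by rewrite mem_enum -(permKV p i) mem_map ?mem_enum //; apply: perm_inj.
Qed.

Lemma word_surj n (w : seq nat) :
  perm_eq w (iota 0 n) -> exists p : 'S_n, word p = w.
Proof.
move=> pw.
have sw : size w = n by rewrite (perm_size pw) size_iota.
have uw : uniq w by rewrite (perm_uniq pw) iota_uniq.
(* The default [i] is never taken, since every entry of [w] is below [n]. *)
pose f (i : 'I_n) : 'I_n := insubd i (nth 0 w i).
have fE i : val (f i) = nth 0 w i.
  rewrite val_insubd; case: ifP => // /negP[].
  have: nth 0 w i \in w by rewrite mem_nth ?sw.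
  by rewrite (perm_mem pw) mem_iota.
have f_inj : injective f.
  move=> i j /(congr1 val); rewrite !fE => /eqP.
  by rewrite nth_uniq ?sw // => /eqP/val_inj.
exists (perm f_inj); apply: (@eq_from_nth _ 0); rewrite size_word ?sw //.
move=> i lt_i; rewrite -[i]/(val (Ordinal lt_i)) nth_word permE; exact: fE.
Qed.

(** * The avoiders as a recursively built list *)

(* The recursion has depth two, so it iterates the pair of the words of size
   [n] and those of size [n.+1]. *)
Fixpoint avoider_words2 n : seq (seq nat) * seq (seq nat) :=
  if n is m.+1 then
    let: (W0, W1) := avoider_words2 m in
    (W1, [seq m.+1 :: w | w <- W1] ++ [seq m :: m.+1 :: w | w <- W0])
  else ([:: [::]], [:: [:: 0]]).

Definition avoider_words n := (avoider_words2 n).1.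

Lemma avoider_wordsS n : avoider_words n.+2 =
  [seq n.+1 :: w | w <- avoider_words n.+1] ++
  [seq n :: n.+1 :: w | w <- avoider_words n].
Proof. by rewrite /avoider_words /=; case: (avoider_words2 n). Qed.

Lemma nat_ind2 (P : nat -> Prop) :
  P 0 -> P 1 -> (forall n, P n -> P n.+1 -> P n.+2) -> forall n, P n.
Proof.
move=> P0 P1 PS n; suff []: P n /\ P n.+1 by [].
by elim: n => // n [Pn Pn1]; split=> //; apply: PS.
Qed.

Lemma uniq_avoider_words n : uniq (avoider_words n).
Proof.
elim/nat_ind2: n => // n u0 u1.
rewrite avoider_wordsS cat_uniq !map_inj_uniq ?u0 ?u1; first last.
- by move=> v w [].
- by move=> v w [].
(* The two halves are disjoint because their words start with different letters. *)
rewrite andbT /=; apply/hasPn => _ /mapP[v _ ->]; apply/negP => /mapP[w _ []].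
lia.
Qed.

Lemma perm_iota_max n (v : seq nat) :
  perm_eq (n :: v) (iota 0 n.+1) = perm_eq v (iota 0 n).
Proof.
have P : perm_eq (iota 0 n.+1) (n :: iota 0 n).
  by rewrite -[n.+1]addn1 iotaD add0n /= cats1 perm_rcons.
by rewrite (permPr P) perm_cons.
Qed.

Lemma perm_iota_max2 n (v : seq nat) :
  perm_eq [:: n, n.+1 & v] (iota 0 n.+2) = perm_eq v (iota 0 n).
Proof.
rewrite -[RHS]perm_iota_max -[RHS]perm_iota_max.
by apply: (permPl (permEl (perm_catCA [:: n] [:: n.+1] v))).
Qed.

Lemma perm_iota_lt n (v : seq nat) :
  perm_eq v (iota 0 n) -> all (gtn n) v.
Proof. by move=> pv; apply/allP => c; rewrite (perm_mem pv) mem_iota. Qed.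

Lemma gap_decreasing_cons a (v : seq nat) :
  all (gtn a) v -> gap_decreasing v -> gap_decreasing (a :: v).
Proof.
move=> av gv a' b c /=; case: eqP => [->|_]; last exact: gv.
by move=> /mem_subseq H; apply: (allP av); apply: H; rewrite !inE eqxx orbT.
Qed.

(** In a triple starting at the leading [a], the third entry lies in [v], so [a] and [b] may come in
    either order. *)
Lemma gap_decreasing_cons2 a b (v : seq nat) :
  all (gtn a) v -> gap_decreasing (b :: v) -> gap_decreasing [:: a, b & v].
Proof.
move=> av gv a' b' c'; rewrite [subseq _ _]/=; case: eqP => [-> H|_ H].
  apply: (allP av); move: H; case: eqP => _; first by rewrite sub1seq.
  by move=> /mem_subseq H; apply: H; rewrite !inE eqxx orbT.
exact: gv H.
Qed.

Lemma mem_gap_decreasing a b (v : seq nat) c :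
  gap_decreasing [:: a, b & v] -> c \in v -> c < a.
Proof. by move=> gw cv; apply: (gw a b c); rewrite /= !eqxx sub1seq. Qed.

Lemma mem_avoider_words n (w : seq nat) :
  w \in avoider_words n <-> perm_eq w (iota 0 n) /\ gap_decreasing w.
Proof.
elim/nat_ind2: n w => [w|w|n IH0 IH1 w].
- rewrite inE; split=> [/eqP-> //|[pw _]].
  by rewrite -size_eq0 (perm_size pw).
- rewrite inE; split=> [/eqP->|[pw _]]; last by rewrite (perm_small_eq _ pw).
  by split=> // a b c /size_subseq.
rewrite avoider_wordsS mem_cat; split.
  case/orP=> /mapP[v]; rewrite (IH0, IH1) => -[pv gv] ->.
    rewrite perm_iota_max pv; split=> //.
    by apply: gap_decreasing_cons => //; apply: perm_iota_lt.
  rewrite perm_iota_max2 pv; split=> //; apply: gap_decreasing_cons2.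
    exact: perm_iota_lt.
  apply: gap_decreasing_cons => //; apply: sub_all (perm_iota_lt pv) => c /=.
  by move/ltnW.
case: w => [|a [|b v]] [pw gw]; try by have := perm_size pw; rewrite size_iota.
have mw := perm_mem pw.
have uw : uniq [:: a, b & v] by rewrite (perm_uniq pw) iota_uniq.
have lta : a < n.+2 by have := mw a; rewrite mem_iota inE eqxx => /esym.
have [ea|na] := eqVneq a n.+1.
  rewrite ea in pw gw *; apply/orP; left; apply: map_f; apply/IH1.
  rewrite -perm_iota_max pw; split=> //.
  by apply: gap_decreasing_subseq gw; apply: subseq_cons.
(* If the maximum [n.+1] were in [v], it would be below [a]. *)
have eb : b = n.+1.
  have: n.+1 \in [:: a, b & v] by rewrite mw mem_iota; lia.
  rewrite !inE eq_sym (negbTE na) /=.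
  case/orP => [/eqP-> //|/(mem_gap_decreasing gw)]; lia.
(* Now [a] is at most [n], so [n] cannot lie in [v], whose entries are below [a]. *)
have ea : a = n.
  have: n \in [:: a, b & v] by rewrite mw mem_iota; lia.
  rewrite !inE eb.
  have [-> //|_] := eqVneq n a; have -> : (n == n.+1) = false by lia.
  by move/(mem_gap_decreasing gw); lia.
rewrite ea eb in pw gw *; apply/orP; right; apply: (map_f (fun w => [:: _, _ & w])).
apply/IH0; rewrite -perm_iota_max2 pw; split=> //.
by apply: gap_decreasing_subseq gw; apply: (@suffix_subseq _ [:: n; n.+1]).
Qed.

(** This turns sums over [avoiders n] into sums over the recursive list: both sides are
    duplicate-free with the same members. *)
Lemma perm_avoider_words n :
  perm_eq [seq word p | p <- enum (avoiders n)] (avoider_words n).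
Proof.
apply: uniq_perm; rewrite ?uniq_avoider_words //.
  by rewrite map_inj_uniq ?enum_uniq //; apply: word_inj.
move=> w; apply/idP/idP.
  case/mapP=> p; rewrite mem_enum => /avoidersP gp ->.
  by apply/mem_avoider_words; split=> //; apply: perm_eq_word.
case/mem_avoider_words => /word_surj[p <-] gp.
by apply: map_f; rewrite mem_enum; apply/avoidersP.
Qed.

(** * Inversions and runs under prepending of large letters *)

(** Inversions are grouped by their left entry, so a prepended letter adds a single term. *)
Fixpoint word_inv (w : seq nat) : nat :=
  if w is a :: v then count (gtn a) v + word_inv v else 0.

Lemma word_invE (w : seq nat) :
  \sum_(i < size w) \sum_(j < size w)
    ((i < j) && (nth 0 w j < nth 0 w i) : nat) = word_inv w.
Proof.
elim: w => [|a v IH] /=; first by rewrite big_ord0.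
(* Row 0 of the double sum is the count for the head; column 0 vanishes in the other rows, as no
   index is below 0. *)
rewrite big_ord_recl big_ord_recl /= add0n; congr (_ + _).
  rewrite -sum1_count (big_nth 0) big_mkord [RHS]big_mkcond /=.
  by apply: eq_bigr => i _; rewrite add0n; case: ifP.
rewrite -IH; apply: eq_bigr => i _; rewrite big_ord_recl /= add0n.
by apply: eq_bigr.
Qed.

Lemma inv_word n (p : 'S_n) : Defs.inv p = word_inv (word p).
Proof.
rewrite -word_invE size_word /Defs.inv cardsE -sum1_card big_mkcond pair_big /=.
by apply: eq_bigr => -[i j] _; rewrite !nth_word unfold_in /=; case: (_ && _).
Qed.

(** The head of [v], if any, is below [a], so a run breaks right after [a]. *)
Lemma runs_cons_max a (v : seq nat) :
  all (gtn a) v -> runs (a :: v) = [:: a] :: runs v.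
Proof.
move=> /= av; have := flatten_runs v; have := runs_nonempty v.
case: (runs v) => [|[|b r] rs] //= _ ev.
have /= lt_ba := allP av b; rewrite ltnNge ltnW // lt_ba //.
by rewrite -ev inE eqxx.
Qed.

Lemma runs_cons2_max a b (v : seq nat) :
  a < b -> all (gtn b) v -> runs [:: a, b & v] = [:: a; b] :: runs v.
Proof.
move=> ab bv.
by rewrite -[runs _]/(match runs (b :: v) with
  | (c :: r) :: rs => if a < c then (a :: c :: r) :: rs
                      else [:: a] :: (c :: r) :: rs
  | _ => [:: [:: a]] end) runs_cons_max // ab.
Qed.

(** * Recurrence for the generating function and the identity *)

Local Open Scope ring_scope.

Section Recurrence.

Variables (R : comNzRingType) (x y q : R).

Definition weight (w : seq nat) : R :=
  x ^+ count (fun r => size r == 1%N) (runs w) *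
  y ^+ count (fun r => size r == 2%N) (runs w) * q ^+ word_inv w.

Lemma FI_avoider_words n : FI n x y q = \sum_(w <- avoider_words n) weight w.
Proof.
rewrite -(perm_big _ (perm_avoider_words n)) big_map big_enum /=.
by apply: eq_bigr => p _; rewrite inv_word.
Qed.

Lemma weight_cons_max n (v : seq nat) : perm_eq v (iota 0 n) ->
  weight (n :: v) = x * q ^+ n * weight v.
Proof.
move=> pv; have lt_v := perm_iota_lt pv.
rewrite /weight runs_cons_max //= add0n !exprD expr1.
move: lt_v; rewrite all_count (perm_size pv) size_iota => /eqP->.
ring.
Qed.

(** Both new letters exceed all [n] letters of [v] and form no inversion with each other, whence the
    exponent [2 * n]. *)
Lemma weight_cons2_max n (v : seq nat) : perm_eq v (iota 0 n) ->
  weight [:: n, n.+1 & v] = y * q ^+ (2 * n) * weight v.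
Proof.
move=> pv; have lt_v := perm_iota_lt pv.
have lt_v' : all (gtn n.+1) v by apply: sub_all lt_v => c /= /ltnW.
rewrite /weight runs_cons2_max // [word_inv _]/= ltnNge leqnSn.
move: lt_v lt_v'; rewrite !all_count (perm_size pv) size_iota.
move=> /eqP-> /eqP->; rewrite /= mul2n -addnn !exprD !expr0 expr1.
ring.
Qed.

Lemma FI_rec n :
  FI n.+2 x y q = x * q ^+ n.+1 * FI n.+1 x y q + y * q ^+ (2 * n) * FI n x y q.
Proof.
rewrite !FI_avoider_words avoider_wordsS big_cat !big_map /= !big_distrr /=.
congr (_ + _); rewrite !big_seq; apply: eq_bigr => w /mem_avoider_words[pw _].
  exact: weight_cons_max.
exact: weight_cons2_max.
Qed.

Lemma FI1 : FI 1 x y q = x.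
Proof.
rewrite FI_avoider_words /avoider_words /= big_seq1 /weight /=.
by rewrite !expr0 !mulr1 expr1.
Qed.

End Recurrence.

Theorem theorem4p7 (R : comNzRingType) (x y q : R) (n : nat) :
  FI n.+1 x y q * FI n x y q =
  \sum_(0 <= j < n.+1)
     x * y ^+ (n - j)%N * q ^+ ((n - j) * (n + j - 1) + j)%N
       * (FI j x y q) ^+ 2.
Proof.
elim: n => [|n IH]; first by rewrite big_nat1 FI1 FI0 !expr0 expr1n !mulr1.
(* After distributing, the [y] term contains the product of the two previous generating functions,
   to which the induction hypothesis applies. *)
rewrite FI_rec mulrDl -[X in _ + X]mulrA [FI n x y q * _]mulrC IH.
(* The [x] term is the new summand [j = n.+1]; the other summands are the old ones times
   [y * q ^+ (2 * n)]. *)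
rewrite [RHS]big_nat_recr //= subnn mul0n add0n expr0 [LHS]addrC; congr (_ + _).
  rewrite big_distrr /= !big_nat; apply: eq_bigr => j /andP[_ le_jn].
  rewrite subSn // (exprS y).
  (* With [n = j + k] this is (k+1)(2j+k) = 2(j+k) + k(2j+k-1). *)
  have -> : ((n - j).+1 * (n.+1 + j - 1) + j =
            2 * n + ((n - j) * (n + j - 1) + j))%N.
    have [k ->] : exists k, n = (j + k)%N by exists (n - j)%N; lia.
    (* The subtraction in [j + k + j - 1] can truncate only for [k = 0], where it is multiplied by
       0. *)
    rewrite addKn; case: k => [|k]; first lia.
    have -> : ((j + k.+1).+1 + j - 1 = 2 * j + k.+1)%N by lia.
    have -> : (j + k.+1 + j - 1 = 2 * j + k)%N by lia.
    by nia.
  rewrite [in RHS]exprD; ring.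
by rewrite mulr1 expr2 mulrA.
Qed.
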